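(* Let $v>9$ and $k$ be positive integers satisfying $(2v-1)^2-2(2k+1)^2=-49$, and let $e=m=\frac12\binom v2$. Then, with $k_e,j,k',j'$ the unique integers such that $e=\binom{k_e+1}2-j$, $1\le j\le k_e$, and $e=\binom v2-\binom{k'+1}2+j'$, $1\le j'\le k'$, we have $j=j'=3$ and $k_e=k'=k$, and there are exactly four optimal partitions in $\mathrm{Dis}(v,e)$, namely $\pi_{1.1}=(v-1,v-2,\dots,k+1,3)$, $\pi_{1.3}=(v-1,v-2,\dots,k+1,2,1)$, $\pi_{2.1}=(k,k-1,\dots,4,2,1)$, $\pi_{2.3}=(k,k-1,\dots,4,3)$. The partitions $\pi_{1.2}$ and $\pi_{2.2}$ do not exist.
   Context: $\mathcal G(v,e)$ is the set of simple graphs with $v$ vertices and $e$ edges; $P_2(G)$ is the sum of squares of the degrees. $\mathrm{Dis}(v,e)$ is the set of partitions $(a_0,\dots,a_p)$ of $e$ into distinct parts with $v>a_0>\dots>a_p>0$. The threshold graph $\mathrm{Th}(\pi)$ has vertex set $\{0,\dots,v-1\}$ and, for $s=0,\dots,p$, edges $\{s,s+1\},\dots,\{s,s+a_s\}$. A partition $\pi\in\mathrm{Dis}(v,e)$ is optimal if $P_2(\mathrm{Th}(\pi))$ is maximal over $\mathcal G(v,e)$. With $k_e,j,k',j'$ as in the claim: $\pi_{1.1}=(v-1,\dots,k'+1,j')$; $\pi_{1.2}=(v-1,\dots,\widehat{2k'-j'-1},\dots,k'-1)$, defined only if $k'+1\le 2k'-j'-1\le v-1$; $\pi_{1.3}=(v-1,\dots,k'+1,2,1)$,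 defined only if $j'=3$ and $v\ge4$; $\pi_{2.1}=(k_e,\dots,\widehat j,\dots,1)$; $\pi_{2.2}=(2k_e-j-1,k_e-2,\dots,2,1)$, defined only if $k_e+1\le 2k_e-j-1\le v-1$; $\pi_{2.3}=(k_e,k_e-1,\dots,3)$, defined only if $j=3$ and $v\ge4$. (Hats denote omitted entries from a run of consecutive integers.) *)

(* Defs.v *)
From mathcomp Require Import all_boot all_order all_algebra.
From mathcomp Require Import zify.

Set Implicit Arguments.
Unset Strict Implicit.
Unset Printing Implicit Defensive.

(* A graph on the vertex set {0, ..., v-1} is given by its set of edges. *)
Definition graphs (v e : nat) : {set {set {set 'I_v}}} :=
  [set E : {set {set 'I_v}} | (#|E| == e) && [forall f in E, #|f| == 2]].

Definition deg (v : nat) (E : {set {set 'I_v}}) (x : 'I_v) : nat :=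
  #|[set f in E | x \in f]|.

Definition P2 (v : nat) (E : {set {set 'I_v}}) : nat :=
  \sum_(x < v) deg E x ^ 2.

Definition Dis (v e : nat) (pi : seq nat) : bool :=
  [&& sorted gtn pi, all (fun a => 0 < a < v) pi & sumn pi == e].

(* The default value 0 of nth makes the condition empty for s >= size pi.     *)
(* For pi in Dis(v,e) the bound s + a_s <= v - 1 holds, so that restricting   *)
(* t to 'I_v loses no edge: see Th_graphs.                                    *)
Definition Th (v : nat) (pi : seq nat) : {set {set 'I_v}} :=
  [set f : {set 'I_v} |
    [exists s : 'I_v, exists t : 'I_v,
      (f == [set s; t]) && (s < t <= s + nth 0 pi s)]].

Definition optimal (v e : nat) (pi : seq nat) : bool :=
  Dis v e pi && [forall E in graphs v e, P2 E <= P2 (Th v pi)].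

(* e = C(ke+1, 2) - j, without truncated subtraction. *)
Definition lower_params (e ke j : nat) : bool :=
  (e + j == 'C(ke.+1, 2)) && (1 <= j <= ke).

(* e = C(v, 2) - C(k'+1, 2) + j', without truncated subtraction. *)
Definition upper_params (v e k' j' : nat) : bool :=
  (e + 'C(k'.+1, 2) == 'C(v, 2) + j') && (1 <= j' <= k').

(* The run a, a-1, ..., b; it is empty if a < b. *)
Definition run (a b : nat) : seq nat := rev (iota b (a.+1 - b)).

Definition run_omit (a c b : nat) : seq nat := [seq i <- run a b | i != c].

(* None means that the partition is not defined. In pi12 and pi22 the         *)
(* subtraction is harmless: if it truncates, then the lower bound fails.      *)
Definition pi11 (v k' j' : nat) : option (seq nat) :=
  Some (run (v - 1) (k' + 1) ++ [:: j']).

Definition pi12 (v k' j' : nat) : option (seq nat) :=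
  if k' + 1 <= 2 * k' - j' - 1 <= v - 1
  then Some (run_omit (v - 1) (2 * k' - j' - 1) (k' - 1)) else None.

Definition pi13 (v k' j' : nat) : option (seq nat) :=
  if (j' == 3) && (4 <= v)
  then Some (run (v - 1) (k' + 1) ++ [:: 2; 1]) else None.

Definition pi21 (ke j : nat) : option (seq nat) := Some (run_omit ke j 1).

Definition pi22 (v ke j : nat) : option (seq nat) :=
  if ke + 1 <= 2 * ke - j - 1 <= v - 1
  then Some (2 * ke - j - 1 :: run (ke - 2) 1) else None.

Definition pi23 (v ke j : nat) : option (seq nat) :=
  if (j == 3) && (4 <= v) then Some (run ke 3) else None.

Lemma Dis_bound v pi s : sorted gtn pi -> all (fun a => 0 < a < v) pi ->
  s < size pi -> s + nth 0 pi s < v.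
Proof.
elim: s => [|s IHs] so al ss.
  by have /andP[] := allP al _ (mem_nth 0 ss).
have := IHs so al (ltnW ss).
have gt_trans : transitive gtn by move=> a b c /= ba cb; exact: ltn_trans cb ba.
have := sorted_ltn_nth gt_trans 0 so s s.+1 (ltnW ss) ss (ltnSn s).
rewrite /=; lia.
Qed.

Lemma Th_graphs v e pi : Dis v e pi -> Th v pi \in graphs v e.
Proof.
case/and3P=> so al /eqP se.
pose A := [set p : 'I_v * 'I_v | p.1 < p.2 <= p.1 + nth 0 pi p.1].
have ThE : Th v pi = [set [set p.1; p.2] | p in A].
  apply/setP=> f; rewrite inE; apply/existsP/imsetP.
    case=> s /existsP[t /andP[/eqP-> h]].
    by exists (s, t) => //; rewrite inE.
  case=> -[s t]; rewrite inE /= => h ->.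
  by exists s; apply/existsP; exists t; rewrite eqxx.
rewrite inE; apply/andP; split; last first.
  apply/forall_inP=> f; rewrite inE => /existsP[s /existsP[t /andP[/eqP-> h]]].
  by rewrite cards2 -val_eqE /=; have -> : (s : nat) != t by lia.
rewrite ThE card_in_imset; last first.
  move=> [s t] [s' t']; rewrite !inE /= => h h' /setP E.
  have := E s; have := E t; have := E s'; have := E t'.
  rewrite !inE !eqxx ?orbT /= -!val_eqE /=.
  by move=> *; congr pair; apply: val_inj => /=; lia.
have size_le : size pi <= v.
  case: (posnP (size pi)) => [->//|sp].
  have := Dis_bound so al (_ : (size pi).-1 < size pi).
  rewrite prednK // leqnn => /(_ isT); lia.
rewrite -se sumnE (big_nth 0) (big_nat_widen _ _ v) //=.
rewrite -sum1_card (eq_bigl (fun p : 'I_v * 'I_v =>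
  true && (p.1 < p.2 <= p.1 + nth 0 pi p.1))); last by move=> p; rewrite inE.
rewrite -(pair_big_dep xpredT (fun s t : 'I_v => s < t <= s + nth 0 pi s)
  (fun _ _ => 1)) /=.
rewrite big_mkord; apply/eqP.
rewrite [RHS]big_mkcond /=; apply: eq_bigr => s _.
case: ltnP => hs; last first.
  by rewrite big1 // => t; rewrite nth_default //; lia.
have hb := Dis_bound so al hs.
rewrite -(big_mkord (fun t => s < t <= s + nth 0 pi s) (fun=> 1)).
rewrite (big_cat_nat (n := s.+1)) //= [X in X + _]big_nat_cond big1 ?add0n; last first.
  by move=> t; lia.
rewrite (big_cat_nat (n := (s + nth 0 pi s).+1)) //=; last by lia.
rewrite [X in _ + X]big_nat_cond [X in _ + X]big1 ?addn0; last first.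
  by move=> t; lia.
rewrite big_nat_cond (eq_bigl (fun t => (s < t < (s + nth 0 pi s).+1) && true)).
  by rewrite -big_nat_cond sum_nat_const_nat muln1; lia.
by move=> t; lia.
Qed.

(* Main.v *)
(* A threshold graph is a word in dominating and isolated vertices.           *)
(* A graph maximizing P_2 has a dominating or an isolated vertex: if x has    *)
(* maximal degree and some y has a neighbour z that x has not, then replacing *)
(* the edge yz by xz increases P_2. By induction every graph is therefore     *)
(* bounded by a threshold graph with as many vertices and edges.              *)
(* Optimality of words passes to the subwords left after deleting the last    *)
(* vertices added, and to complements. An optimal word is thus built letter   *)
(* by letter from optimal ones, and comparing with explicit words shows that  *)
(* a letter leading out of the six families of the paper destroys optimality. *)
(* For the given v and k the families contain only four words with e edges:   *)
(* pi_2.1, pi_2.3 and their complements pi_1.1, pi_1.3, which have the same   *)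
(* P_2, because e is half of the total number of edges.                       *)

(* With n = v - 1 the Pell equation reads C(v,2) + 6 = 2 C(k+1,2), so e = C(k+1,2) - 3; since C(v,2)
   = 2e, the upper parameters are (k, 3) as well. [sqdeg_le_wP2] reduces optimality among graphs to
   optimality among words, and [optimalP] transfers it to partitions. By [wopt_quasi] an optimal
   word or its complement is quasi-complete. With the given size and number of edges,
   [quasi_complete_eq] leaves one word in the first family, one in the third, and none in the second
   because n < 2k - 4. These two words and their complements share one value of P_2. A maximum
   exists ([exists_wopt]) and can only be attained among the four, so all four attain it. *)
Require Import Defs.
From mathcomp Require Import all_boot all_order all_algebra.
From mathcomp Require Import zify ring.

Set Implicit Arguments.
Unset Strict Implicit.
Unset Printing Implicit Defensive.

(** * Words and their optimality *)

(* A word encodes a threshold graph on (size w).+1 vertices: starting from a  *)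
(* single vertex and reading from the right, true adds a vertex joined to all *)
(* previous ones and false adds an isolated vertex.                           *)
Fixpoint wedges (w : seq bool) : nat :=
  if w is b :: u then (if b then (size u).+1 else 0) + wedges u else 0.

(** A vertex joined to n old vertices raises each of their degrees by one, which adds 4e + n to the
    sum of squares, and contributes n^2 itself. *)
Fixpoint wP2 (w : seq bool) : nat :=
  if w is b :: u then
    (if b then 4 * wedges u + (size u).+1 + (size u).+1 ^ 2 else 0) + wP2 u
  else 0.

Definition wopt (w : seq bool) : Prop :=
  forall w', size w' = size w -> wedges w' = wedges w -> wP2 w' <= wP2 w.

Definition dom a (w : seq bool) := nseq a true ++ w.
Definition iso a (w : seq bool) := nseq a false ++ w.

Lemma size_dom a w : size (dom a w) = a + size w.
Proof. by rewrite size_cat size_nseq. Qed.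

Lemma size_iso a w : size (iso a w) = a + size w.
Proof. by rewrite size_cat size_nseq. Qed.

Lemma dom_add a b w : dom (a + b) w = dom a (dom b w).
Proof. by rewrite /dom nseqD catA. Qed.

Lemma iso_add a b w : iso (a + b) w = iso a (iso b w).
Proof. by rewrite /iso nseqD catA. Qed.

(** Doubling and passing to the integers makes the closed forms polynomial, so comparing explicit
    words becomes arithmetic. *)
Lemma wedges_dom a w : ((wedges (dom a w))%:Z * 2 =
  (wedges w)%:Z * 2 + 2 * a%:Z * (size w + 1)%:Z + a%:Z * (a%:Z - 1))%R.
Proof.
elim: a => [|a IH]; first by rewrite /=; ring.
by rewrite [wedges _]/= -/(dom a w) size_dom; move: IH; nia.
Qed.

Lemma wP2_dom a w : ((wP2 (dom a w))%:Z =
  (wP2 w)%:Z + 2 * a%:Z * ((wedges w)%:Z * 2)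
  + a%:Z * (3 * (size w + 1)%:Z * (a%:Z - 1) + (size w + 1)%:Z
            + (size w + 1)%:Z ^+ 2 + (a%:Z - 1) ^+ 2))%R.
Proof.
elim: a => [|a IH]; first by rewrite /=; ring.
rewrite [wP2 _]/= -/(dom a w) size_dom.
have := wedges_dom a w; move: IH.
move: (wP2 w) (wedges w) (size w) (wP2 (dom a w))
  (wedges (dom a w)) => p e s P E hP hE.
have -> : ((4 * E + (a + s).+1 + (a + s).+1 ^ 2 + P)%N%:Z =
  2 * (E%:Z * 2) + (a%:Z + s%:Z + 1) + (a%:Z + s%:Z + 1) ^+ 2 + P%:Z)%R by lia.
rewrite hP hE.
have -> : (a.+1%:Z = a%:Z + 1)%R by lia.
have -> : ((s + 1)%N%:Z = s%:Z + 1)%R by lia.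
by ring.
Qed.

Lemma wedges_iso a w : wedges (iso a w) = wedges w.
Proof. by elim: a. Qed.

Lemma wP2_iso a w : wP2 (iso a w) = wP2 w.
Proof. by elim: a. Qed.

Definition wordE :=
  (wedges_dom, wP2_dom, wedges_iso, wP2_iso, size_dom, size_iso).

Lemma map_negb_dom a w : map negb (dom a w) = iso a (map negb w).
Proof. by rewrite map_cat map_nseq. Qed.

Lemma map_negb_iso a w : map negb (iso a w) = dom a (map negb w).
Proof. by rewrite map_cat map_nseq. Qed.

Definition map_negbE := (map_negb_dom, map_negb_iso).

Lemma map_negbK (w : seq bool) : map negb (map negb w) = w.
Proof. exact: (mapK negbK). Qed.

Lemma wedges_compl w :
  (wedges (map negb w) + wedges w) * 2 = (size w).+1 * size w.
Proof. by elim: w => //= -[] w /=; rewrite ?size_map; nia. Qed.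

(** Each degree d becomes n - d with n = [size w]. The correction depends only on size and number of
    edges, so complementation preserves optimality. *)
Lemma wP2_compl w :
  wP2 (map negb w) + 4 * size w * wedges w = wP2 w + (size w).+1 * size w ^ 2.
Proof.
elim: w => //= b w IH; have := wedges_compl w; move: IH.
by case: b; rewrite /= ?size_map; lia.
Qed.

Lemma wopt_compl w : wopt w -> wopt (map negb w).
Proof.
move=> ow w'; rewrite size_map => sw ew.
have ew' : wedges (map negb w') = wedges w.
  by have := wedges_compl w; have := wedges_compl w'; rewrite sw ew; lia.
have := ow _ _ ew'; rewrite size_map => /(_ sw).
have := wP2_compl w; have := wP2_compl (map negb w').
by rewrite map_negbK size_map sw ew'; lia.
Qed.

(** The first letter contributes an amount fixed by the size and number of edges of the tail, so a
    better tail would give a better word. *)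
Lemma wopt_behead b w : wopt (b :: w) -> wopt w.
Proof.
move=> ow w' sw ew; have := ow (b :: w'); rewrite /= sw ew.
by move=> /(_ erefl erefl); lia.
Qed.

Lemma not_wopt_lt w w' : size w' = size w ->
    ((wedges w')%:Z * 2 = (wedges w)%:Z * 2)%R ->
  ((wP2 w)%:Z < (wP2 w')%:Z)%R -> ~ wopt w.
Proof. by move=> sw ew pw /(_ w' sw); lia. Qed.

Lemma wopt_eq w w' : wopt w -> size w' = size w ->
    ((wedges w')%:Z * 2 = (wedges w)%:Z * 2)%R ->
  ((wP2 w')%:Z = (wP2 w)%:Z)%R -> wopt w'.
Proof.
move=> ow sw ew pw w2 sw2 ew2; have := ow w2.
by rewrite sw2 ew2 sw => /(_ erefl); lia.
Qed.

(** * Words that are not optimal *)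

(* The words in the next lemmas are written from the last vertex to the       *)
(* first. With a_0 > a_1 > ... the associated partition,                      *)
(* P_2 = \sum_s (a_s^2 + a_s + 4 s a_s), so moving a unit from row r to row s *)
(* gains 2 (a_s + 2s - a_r - 2r) + 2, and this gain grows with each repeat.   *)
(* The replacing words come from moving enough units in the right direction.  *)
Lemma not_wopt_inner_star a b c : 0 < a ->
  ~ wopt (dom 1 (iso (a + b + c) (dom b.+1 (iso 1 (dom a [::]))))).
Proof.
(* Every row below the second gives one unit to the second. *)
case: a => // a _; by apply: (not_wopt_lt (w' :=
  dom 1 (iso c (dom 1 (iso (a + b).+2 (dom b (iso 1 (dom a [::]))))))));
  rewrite !wordE /=; lia.
Qed.

Lemma not_wopt_inner_clique a b c : 0 < a -> 0 < b -> 0 < c < a + b ->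
  ~ wopt (dom 1 (iso c (dom b (iso 1 (dom a [::]))))).
Proof.
move=> a0 b0 /andP[c0 cab]; have [ca|ac] := leqP c a.
  have cb0 : 0 < c * b by rewrite muln_gt0 c0.
  have [d {a a0 ca cab}->] : exists d, a = c + d by exists (a - c); lia.
  (* The first row gives c units, one to each of the first c rows after the gap. *)
  by apply: (not_wopt_lt (w' :=
    iso c (dom 1 (dom (b + c) (iso 1 (dom d [::]))))));
    rewrite !wordE /=; lia.
have [d cE] : exists d, c = a + d by exists (c - a); lia.
rewrite {}cE in c0 cab ac *; have [f bE] : exists f, b = d + f.+1.
  by exists (b - d).-1; lia.
rewrite {}bE in b0 cab *; have af0 : 0 < a * f.+1 by rewrite muln_gt0 a0.
(* Now c exceeds a, and each of the a rows after the gap gets one unit of the first row. *)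
by apply: (not_wopt_lt (w' :=
  iso a (dom 1 (iso d (dom (a + (d + f.+1)) (iso 1 [::]))))));
  rewrite !wordE /=; lia.
Qed.

Lemma not_wopt_star0 b c :
  ~ wopt (dom 1 (iso (b + c).+2 (dom b.+2 (iso 1 [::])))).
Proof.
by apply: (not_wopt_lt (w' :=
  dom 1 (iso c (dom 1 (iso b.+3 (dom b (iso 1 [::])))))));
  rewrite !wordE /=; lia.
Qed.

Lemma not_wopt_clique0 b c :
  ~ wopt (dom 1 (iso c.+1 (dom (b + c).+1 (iso 1 [::])))).
Proof.
by apply: (not_wopt_lt (w' := iso 1 (dom 1 (iso c (dom (b + c).+2 [::])))));
  rewrite !wordE /=; lia.
Qed.

Lemma not_wopt_clique_star a c :
  ~ wopt (dom 1 (iso (a + c).+3 (dom a.+3 [::]))).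
Proof.
by apply: (not_wopt_lt (w' :=
  dom 1 (iso c (dom 1 (iso a.+4 (dom a (iso 1 [::])))))));
  rewrite !wordE /=; lia.
Qed.

(** The number c of isolated vertices decides the direction: for small c the first row gives units
    to lower rows, otherwise the second row takes units from the rows below it. *)
Lemma not_wopt_dom a b c : 0 < b -> 0 < c -> (0 < a) || (1 < b) ->
  ~ wopt (dom 1 (iso c (dom b (iso 1 (dom a [::]))))).
Proof.
move=> b0 c0; case: (posnP a) => [->|a0] ab.
  have [cb|bc] := ltnP c b.
    have := @not_wopt_clique0 (b - c) c.-1.
    have -> : (b - c + c.-1).+1 = b by lia.
    by rewrite prednK.
  have := @not_wopt_star0 b.-2 (c - b).
  have -> : b.-2.+2 = b by lia.
  by have -> : (b.-2 + (c - b)).+2 = c by lia.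
have [cab|abc] := ltnP c (a + b).
  by apply: not_wopt_inner_clique => //; rewrite c0.
have := @not_wopt_inner_star a b.-1 (c - (a + b.-1)) a0.
by rewrite prednK // subnKC //; lia.
Qed.

(* The word has an equivalent one of the kind excluded by [not_wopt_dom].     *)
Lemma not_wopt_dom_clique a m c : 1 < m <= a.+1 ->
  ~ wopt (dom 1 (iso c (dom 1 (iso m (dom a [::]))))).
Proof.
case: m => // m /andP[m0 ma] ow.
have [d aE] : exists d, a = m + d by exists (a - m); lia.
apply: (@not_wopt_dom d m.+1 (m + c)); try lia.
by apply: (wopt_eq ow); rewrite aE !wordE /=; lia.
Qed.

(** The star on four vertices may be exchanged for a triangle with an isolated vertex: both have 3
    edges and P_2 = 12. *)
Lemma not_wopt_dom_empty b c :
  ~ wopt (dom 1 (iso c.+1 (dom b.+2 (iso 2 [::])))).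
Proof.
move=> ow; apply: (@not_wopt_dom 2 b.+1 c.+1) => //.
by apply: (wopt_eq ow); rewrite !wordE /=; lia.
Qed.

(** * Optimal words lie in the six families *)

(* In terms of the partitions of the paper, the three cases are pi_2.1,       *)
(* pi_2.2 and pi_2.3; complementation exchanges pi_1.i and pi_2.i.            *)
Definition quasi_complete (w : seq bool) : Prop :=
  [\/ exists a b c, w = iso c (dom b (iso 1 (dom a [::]))),
      exists a m c, 1 < m <= a.+1 /\ w = iso c (dom 1 (iso m (dom a [::])))
    | exists b c, w = iso c (dom b.+1 (iso 2 [::]))].

Definition quasi (w : seq bool) : Prop :=
  quasi_complete w \/ quasi_complete (map negb w).

Lemma quasi_cons_true w : quasi_complete w -> wopt (true :: w) ->
  quasi (true :: w).
Proof.
case.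
- case=> [a] [b] [c] ->.
  case: c => [|c]; first by left; constructor 1; exists a, b.+1, 0.
  case: b => [|b]; last first.
    move=> ow; case: (posnP a) => [a0|a0]; last first.
      by case: (@not_wopt_dom a b.+1 c.+1 _ _ _ ow); rewrite ?a0.
    case: b => [|b] in ow *; last first.
      by case: (@not_wopt_dom a b.+2 c.+1 _ _ _ ow); rewrite ?orbT.
    right; constructor 1; exists 1, c.+1, 1.
    by rewrite a0 /= -/(iso c _) map_negbE.
  (* With b = 0 the tail is a clique on a + 1 vertices plus isolated ones. Up to a = 2 the
     complement is quasi-complete; beyond that the word is of the second kind or has enough isolated
     vertices for [not_wopt_clique_star]. *)
  case: a => [|[|[|a]]] ow.
  + right; constructor 1; exists c.+2, 0, 0.
    by rewrite -[true :: _]/(dom 1 _) !map_negbE -[c.+2]addn1 dom_add.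
  + right; constructor 1; exists 0, c.+2, 1.
    by rewrite -[true :: _]/(dom 1 _) !map_negbE -[c.+2]addn1 dom_add.
  + right; constructor 3; exists c.+1, 1.
    by rewrite -[true :: _]/(dom 1 _) !map_negbE -[c.+2]addn1 dom_add.
  have E : iso c.+1 (dom 0 (iso 1 (dom a.+3 [::]))) = iso c.+2 (dom a.+3 [::]).
    by rewrite -[c.+2]addn1 iso_add.
  have [ca|ac] := leqP c.+2 a.+4.
    by left; constructor 2; exists a.+3, c.+2, 0; rewrite -E.
  case: (@not_wopt_clique_star a (c.+2 - a.+3)).
  have -> : (a + (c.+2 - a.+3)).+3 = c.+2 by lia.
  by rewrite -E.
- by case=> [a] [m] [c] [h ->] /(not_wopt_dom_clique h).
case=> [b] [[|c]] ->; first by left; constructor 3; exists b.+1, 0.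
case: b => [|b] => [|/not_wopt_dom_empty[]].
move=> _; right; constructor 1; exists 2, c.+1, 1.
by rewrite /= -/(iso c _) map_negbE.
Qed.

Lemma quasi_complete_cons_false w : quasi_complete w ->
  quasi_complete (false :: w).
Proof.
case.
- by case=> [a] [b] [c] ->; constructor 1; exists a, b, c.+1.
- by case=> [a] [m] [c] [h ->]; constructor 2; exists a, m, c.+1.
by case=> [b] [c] ->; constructor 3; exists b, c.+1.
Qed.

(** Induction on the word. If only the complement of the tail is quasi-complete, the same step is
    applied to the complement of the whole word. *)
Lemma wopt_quasi w : 0 < size w -> wopt w -> quasi w.
Proof.
elim: w => // b [|b' u] IH _ ow.
  by case: b ow; [right|left]; constructor 1; exists 0, 0, 0.
have step w c : quasi_complete w -> wopt (c :: w) -> quasi (c :: w).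
  by case: c => [|qw _]; [exact: quasi_cons_true
                         |left; exact: quasi_complete_cons_false].
case: (IH isT (wopt_behead ow)) => q; first exact: step.
have := step _ (~~ b) q (wopt_compl ow).
rewrite /quasi -[_ :: _]/(map negb [:: b, b' & u]) map_negbK.
by case; [right|left].
Qed.

(** * Words and partitions *)

Fixpoint parts (w : seq bool) : seq nat :=
  if w is b :: u then
    if b then (size u).+1 :: parts u else parts u
  else [::].

Lemma parts_le w : all (fun a => 0 < a <= size w) (parts w).
Proof.
elim: w => //= b w IH.
have: all (fun a => 0 < a <= (size w).+1) (parts w).
  by apply: sub_all IH => a /=; lia.
by case: b => //= ->; rewrite leqnn.
Qed.

Lemma parts_Dis w : Dis (size w).+1 (wedges w) (parts w).
Proof.
apply/and3P; split; first 2 last.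
- by elim: w => //= -[] w /= /eqP->.
- elim: w => //= -[] w //= so.
  rewrite path_min_sorted //; apply: sub_all (parts_le w) => a /=; lia.
by apply: sub_all (parts_le w) => a /=; lia.
Qed.

Lemma parts_onto n pi : sorted gtn pi -> all (fun a => 0 < a <= n) pi ->
  exists w, size w = n /\ parts w = pi.
Proof.
have gt_trans : transitive gtn by move=> x y z /= yx zy; exact: ltn_trans zy yx.
elim: n pi => [|n IH] pi so al.
  by exists [::]; split => //; case: pi al {so} => //= a pi; lia.
have [al'|] := boolP (all (fun a => 0 < a <= n) pi).
  by have [w [<- pw]] := IH _ so al'; exists (false :: w).
case: pi so al => // a pi pa al nal.
have lta := order_path_min gt_trans pa.
have an : a = n.+1.
  apply/eqP; move: al nal => /= /andP[a0 al]; case: eqP => // nan; case/negP.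
  apply/andP; split; first by lia.
  apply/allP => b bpi; have := allP al b bpi; have := allP lta b bpi => /=; lia.
have [|w [sw pw]] := IH pi (path_sorted pa).
  apply/allP => b bpi; have := allP lta b bpi; move: al => /= /andP[_ al].
  by have := allP al b bpi => /=; lia.
by exists (true :: w); rewrite /= sw pw an.
Qed.

Lemma Dis_parts n e pi : Dis n.+1 e pi ->
  exists w, [/\ size w = n, wedges w = e & parts w = pi].
Proof.
case/and3P=> so al se; have [w [sw pw]] := parts_onto so al.
have /and3P[_ _ /eqP se'] := parts_Dis w.
by exists w; split=> //; rewrite -se' pw (eqP se).
Qed.

Definition adj (pi : seq nat) (s t : nat) : bool :=
  (s < t <= s + nth 0 pi s) || (t < s <= t + nth 0 pi t).

Lemma deg_Th v pi (x : 'I_v) : deg (Th v pi) x = \sum_(y < v) adj pi x y.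
Proof.
rewrite /deg.
have -> : [set f in Th v pi | x \in f] =
    [set [set x; y] | y in [set y : 'I_v | adj pi x y]].
  apply/setP => f; rewrite !inE; apply/andP/imsetP.
    case=> /existsP[s /existsP[t /andP[/eqP-> h]]]; rewrite !inE.
    case/orP => /eqP->; first by exists t; rewrite // inE /adj h.
    by exists s; rewrite 1?setUC // inE /adj h orbT.
  case=> y; rewrite inE => /orP[] h ->; split; rewrite ?inE ?eqxx //.
    by apply/existsP; exists x; apply/existsP; exists y; rewrite eqxx.
  by apply/existsP; exists y; apply/existsP; exists x; rewrite setUC eqxx.
rewrite card_in_imset; first by rewrite -sum1dep_card big_mkcond.
move=> y z; rewrite !inE => hy hz /setP E.
have := E y; have := E z; rewrite !inE !eqxx !orbT.
move: hy hz; rewrite /adj -!val_eqE /= => hy hz *.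
by apply: val_inj => /=; lia.
Qed.

Lemma parts_bound w s : s <= size w -> s + nth 0 (parts w) s <= size w.
Proof.
have le_size u : size (parts u) <= size u by elim: u => //= -[] u /=; lia.
elim: w s => [|b w IH] s /=; first by case: s.
case: b; first by case: s => [|s]; rewrite /= ?add0n //; exact: IH.
rewrite leq_eqVlt => /predU1P[->|]; last by rewrite ltnS => /IH; lia.
by rewrite nth_default ?addn0 // leqW.
Qed.

Lemma adj_parts_last w s : s <= size w ->
  adj (parts w) s (size w).+1 = false /\ adj (parts w) (size w).+1 s = false.
Proof. by move=> /parts_bound; rewrite /adj; lia. Qed.

(** The labels of [Th] fit the recursion on words: a new dominating vertex becomes 0 and shifts the
    others, a new isolated vertex takes the last label. *)
Lemma adj_parts w : let v := (size w).+1 in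
  \sum_(x < v) \sum_(y < v) adj (parts w) x y = 2 * wedges w /\
  \sum_(x < v) (\sum_(y < v) adj (parts w) x y) ^ 2 = wP2 w.
Proof.
elim: w => [|[] w [IHe IHp]] v; rewrite {}/v.
- by rewrite !big_ord_recl !big_ord0.
- set v := (size w).+1 in IHe IHp *.
  have row0 : \sum_(y < v.+1) adj (parts (true :: w)) 0 y = v.
    rewrite big_ord_recl /adj /= add0n (eq_bigr (fun=> 1)).
      by rewrite sum1_card card_ord.
    by move=> y _; rewrite /bump /= -/v; have := ltn_ord y; lia.
  have rowS (x : 'I_v) :
      \sum_(y < v.+1) adj (parts (true :: w)) (lift ord0 x) y =
      1 + \sum_(y < v) adj (parts w) x y.
    rewrite big_ord_recl; congr (_ + _).
    by rewrite /adj /= /bump; have := ltn_ord x; rewrite -/v; lia.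
  split; rewrite big_ord_recl row0 /=.
    rewrite (eq_bigr _ (fun x _ => rowS x)) big_split /= sum1_card card_ord IHe.
    by rewrite -/v; lia.
  rewrite (eq_bigr _ (fun x _ => congr1 (fun n => n ^ 2) (rowS x))).
  under eq_bigr => x _ do rewrite sqrnD exp1n mul1n.
  by rewrite !big_split /= sum1_card card_ord big1_eq IHe IHp -/v; lia.
set v := (size w).+1 in IHe IHp *.
have row (x : 'I_v) :
    \sum_(y < v.+1) adj (parts w) x y = \sum_(y < v) adj (parts w) x y.
  rewrite big_ord_recr /= (adj_parts_last (ltn_ord x)).1 addn0; exact: eq_bigr.
have rowv : \sum_(y < v.+1) adj (parts w) v y = 0.
  rewrite big_ord_recr /= big1 => [|y _]; first by rewrite /adj; lia.
  by rewrite (adj_parts_last (ltn_ord y)).2.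
split; rewrite big_ord_recr /= rowv ?addn0.
  by rewrite (eq_bigr _ (fun x _ => row x)).
by rewrite (eq_bigr _ (fun x _ => congr1 (fun n => n ^ 2) (row x))).
Qed.

Lemma P2_Th_parts w : P2 (Th (size w).+1 (parts w)) = wP2 w.
Proof.
by rewrite -(adj_parts w).2 /P2; apply: eq_bigr => x _; rewrite deg_Th.
Qed.

(** * Reduction of graphs to words *)

Section Graphs.

Variable T : finType.
Implicit Types (V : {set T}) (E : {set {set T}}).

(** The vertex set is a subset of a fixed type, so that deleting a vertex stays within the type. *)
Definition graph_on V E := [forall f in E, (#|f| == 2) && (f \subset V)].

Definition vdeg E (x : T) : nat := #|[set f in E | x \in f]|.

Definition sqdeg V E := \sum_(x in V) vdeg E x ^ 2.

Lemma vdegE E x : vdeg E x = \sum_(f in E) (x \in f).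
Proof.
by rewrite /vdeg -sum1_card big_mkcond [RHS]big_mkcond; apply: eq_bigr => f _;
  rewrite inE; case: (f \in E); case: (x \in f).
Qed.

Lemma sum_vdeg V E : graph_on V E -> \sum_(x in V) vdeg E x = 2 * #|E|.
Proof.
move=> /forall_inP gE; under eq_bigr => x _ do rewrite vdegE.
rewrite exchange_big /= (eq_bigr (fun=> 2)) =>
  [|f /gE /andP[/eqP f2 /subsetP fV]].
  by rewrite sum_nat_const mulnC.
rewrite -f2 -sum1_card big_mkcond [RHS]big_mkcond; apply: eq_bigr => x _.
by have := fV x; case: (x \in f) => [->//|_]; rewrite if_same.
Qed.

Lemma vdeg_switch E f g x : f \in E -> g \notin E ->
  vdeg (g |: E :\ f) x + (x \in f) = vdeg E x + (x \in g).
Proof.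
move=> fE gE; rewrite !vdegE big_setU1 /=; last first.
  by rewrite !inE (negPf gE) andbF.
by rewrite (big_setD1 f fE) /=; lia.
Qed.

(** Only the degrees of x and y change, and the gain is 2 (deg x - deg y) + 2 > 0. *)
Lemma sqdeg_switch V E x y z :
    x \in V -> y \in V -> x != y -> x != z -> y != z ->
    [set y; z] \in E -> [set x; z] \notin E -> vdeg E y <= vdeg E x ->
  sqdeg V E < sqdeg V ([set x; z] |: E :\ [set y; z]).
Proof.
move=> xV yV xy xz yz yzE xzE le_yx; rewrite /sqdeg.
have sw := vdeg_switch _ yzE xzE; set E' := _ |: _ in sw *.
have split_xy F : \sum_(w in V) F w =
    F x + (F y + \sum_(w in V | (w != x) && (w != y)) F w) :> nat.
  rewrite (bigD1 x) //= (bigD1 y) /=; last by rewrite yV eq_sym.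
  by congr (_ + (_ + _)); apply: eq_bigl => w; rewrite andbA.
rewrite !split_xy.
have := sw x; have := sw y; rewrite !inE !eqxx (negPf xy) (negPf xz) /=.
rewrite [y == x]eq_sym (negPf xy) (negPf yz) /= !addn0.
move=> dy dx.
rewrite [X in _ < _ + (_ + X)]
    (eq_bigr (fun w => vdeg E w ^ 2)); last first.
  move=> w /and3P[_ wx wy]; have := sw w.
  by rewrite !inE (negPf wx) (negPf wy) /=; case: (w == z) => /=; lia.
by rewrite !addnA ltn_add2r; nia.
Qed.

Lemma card_switch E f g : f \in E -> g \notin E -> #|g |: E :\ f| = #|E|.
Proof.
move=> fE gE; rewrite cardsU1 !inE (negPf gE) andbF /=.
by rewrite (cardsD1 f E) fE.
Qed.

Lemma vdeg_gt0P V E z : graph_on V E -> 0 < vdeg E z ->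
  exists y, [/\ y \in V, z \in V, y != z & [set y; z] \in E].
Proof.
move=> /forall_inP gE /card_gt0P[f]; rewrite inE => /andP[fE zf].
have /andP[/cards2P[a [b [ab fab]]] /subsetP fV] := gE f fE.
have aV : a \in V by apply: fV; rewrite fab !inE eqxx.
have bV : b \in V by apply: fV; rewrite fab !inE eqxx orbT.
move: zf; rewrite fab !inE => /orP[] /eqP->.
  by exists b; rewrite setUC -fab eq_sym.
by exists a; rewrite -fab.
Qed.

Lemma max_sqdeg_isolated_or_dominating V E : 0 < #|V| -> graph_on V E ->
    (forall E', graph_on V E' -> #|E'| = #|E| -> sqdeg V E' <= sqdeg V E) ->
  (exists2 z, z \in V & vdeg E z = 0) \/
  (exists2 x, x \in V & {in V :\ x, forall z, [set x; z] \in E}).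
Proof.
move=> /card_gt0P[v0 v0V] gE maxE.
have [x] := arg_maxnP (vdeg E) v0V; rewrite -/(x \in V) => xV maxx.
have [/exists_inP[z zV /eqP z0]|/exists_inPn noiso] :=
  boolP [exists z in V, vdeg E z == 0]; [by left; exists z|right].
exists x => // z; rewrite !inE => /andP[zx zV]; apply/negPn/negP => xzE.
have := noiso z zV; rewrite -lt0n => /(vdeg_gt0P gE)[y [yV _ yz yzE]].
have xy : x != y by apply: contraNneq xzE => ->.
have := sqdeg_switch xV yV xy _ yz yzE xzE (maxx _ yV).
rewrite eq_sym => /(_ zx); apply/negP; rewrite -leqNgt; apply: maxE.
  apply/forall_inP => f; rewrite !inE => /predU1P[->|/andP[_ fE]]; last first.
    exact: (forall_inP gE).
  by rewrite cards2 [x == z]eq_sym zx subUset !sub1set xV zV.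
exact: card_switch.
Qed.

Lemma exists_max_sqdeg V E : graph_on V E ->
  exists E', [/\ graph_on V E', #|E'| = #|E|, sqdeg V E <= sqdeg V E' &
    forall E2, graph_on V E2 -> #|E2| = #|E'| -> sqdeg V E2 <= sqdeg V E'].
Proof.
move=> gE; have P0 : graph_on V E && (#|E| == #|E|) by rewrite gE eqxx.
have [E' /andP[gE' /eqP cE'] maxE'] :=
  @arg_maxnP _ E (fun F => graph_on V F && (#|F| == #|E|)) (sqdeg V) P0.
exists E'; split=> // [|E2 gE2 cE2]; apply: maxE' => //.
by rewrite gE2 cE2 cE' eqxx.
Qed.

Lemma graph_del_isolated V E z : graph_on V E -> z \in V -> vdeg E z = 0 ->
  graph_on (V :\ z) E /\ sqdeg V E = sqdeg (V :\ z) E.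
Proof.
move=> gE zV z0; split; last by rewrite /sqdeg (big_setD1 z zV) /= z0 add0n.
apply/forall_inP => f fE; have /andP[-> fV] := forall_inP gE f fE.
rewrite subsetD1 fV /=; apply/negP => zf.
by have := cards0_eq z0 => /setP/(_ f); rewrite !inE fE zf.
Qed.

Lemma graph_del_dominating V E x : graph_on V E -> x \in V ->
    {in V :\ x, forall z, [set x; z] \in E} ->
  let n := #|V :\ x| in
  let E' := [set f in E | x \notin f] in
  [/\ graph_on (V :\ x) E', #|E| = n + #|E'| &
      sqdeg V E = 4 * #|E'| + n + n ^ 2 + sqdeg (V :\ x) E'].
Proof.
move=> gE xV domx n E'.
have star : [set f in E | x \in f] = [set [set x; z] | z in V :\ x].
  apply/setP => f; rewrite !inE; apply/andP/imsetP => [[fE xf]|[z zV ->]].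
    have /andP[/cards2P[a [b [ab fab]]] /subsetP fV] := forall_inP gE f fE.
    have aV : a \in V by apply: fV; rewrite fab !inE eqxx.
    have bV : b \in V by apply: fV; rewrite fab !inE eqxx orbT.
    move: xf; rewrite fab !inE => /orP[] /eqP->.
      by exists b; rewrite // !inE eq_sym ab.
    by exists a; rewrite 1?setUC // !inE ab.
  by rewrite domx // !inE eqxx.
have degx : vdeg E x = n.
  rewrite /vdeg star card_in_imset // => y z; rewrite !inE.
  move=> /andP[yx _] /andP[zx _] /setP/(_ y).
  by rewrite !inE eqxx (negPf yx) /= => /esym/eqP.
have gE' : graph_on (V :\ x) E'.
  apply/forall_inP => f; rewrite inE => /andP[fE xf].
  by have /andP[-> fV] := forall_inP gE f fE; rewrite subsetD1 fV.
have cE : #|E| = n + #|E'|.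
  rewrite -degx /vdeg -(cardsID [set f : {set T} | x \in f] E); congr (_ + _).
    by apply: eq_card => f; rewrite !inE andbC.
  by apply: eq_card => f; rewrite !inE andbC.
have degz z : z \in V :\ x -> vdeg E z = vdeg E' z + 1.
  move=> zV; rewrite /vdeg -(cardsID [set f : {set T} | x \in f]) addnC.
  congr (_ + _).
    by apply: eq_card => f; rewrite !inE -andbA; bool_congr; rewrite andbC.
  rewrite (_ : _ :&: _ = [set [set x; z]]) ?cards1 //.
  apply/setP => f; rewrite !inE; apply/idP/eqP => [/andP[/andP[fE zf] xf]|->].
    have : f \in [set f in E | x \in f] by rewrite inE fE.
    rewrite star => /imsetP[y yV fy]; rewrite fy; congr [set _; _].
    by move: zf zV; rewrite fy !inE => /predU1P[->|/eqP->//]; rewrite eqxx.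
  by rewrite (domx z zV) !inE !eqxx orbT.
split=> //; rewrite /sqdeg (big_setD1 x xV) /= degx.
rewrite (eq_bigr (fun z => vdeg E' z ^ 2 + (1 + vdeg E' z * 2))); last first.
  by move=> z zV; rewrite degz // sqrnD; lia.
rewrite big_split big_split /= sum1_card -big_distrl /= (sum_vdeg gE').
rewrite -/n -/(sqdeg (V :\ x) E').
by move: (sqdeg _ _) (n : nat) #|E'| => S m e; lia.
Qed.

(** The graph is first replaced by a maximizer with as many edges, which has a vertex to delete; the
    rest need not be maximal for the induction. *)
Lemma sqdeg_le_wP2 n V E : #|V| = n.+1 -> graph_on V E ->
  exists w, [/\ size w = n, wedges w = #|E| & sqdeg V E <= wP2 w].
Proof.
elim: n V E => [|n IH] V E cV gE.
  exists [::]; have [x Vx] : exists x, V = [set x] by apply/cards1P/eqP.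
  have E0 : #|E| = 0.
    apply/eqP; rewrite cards_eq0; apply/set0Pn => -[f /(forall_inP gE)].
    move=> /andP[/eqP f2 /subset_leq_card]; lia.
  split=> //; rewrite /sqdeg big1 // => y yV.
  by rewrite vdegE (cards0_eq E0) big_set0.
have [F [gF <- leEF maxF]] := exists_max_sqdeg gE.
have cV0 : 0 < #|V| by rewrite cV.
have cD x : x \in V -> #|V :\ x| = n.+1.
  by move=> xV; move: cV; rewrite (cardsD1 x) xV => -[].
case: (max_sqdeg_isolated_or_dominating cV0 gF maxF) => -[x xV hx].
  have [gF' sF] := graph_del_isolated gF xV hx.
  have [w [sw ew pw]] := IH _ _ (cD x xV) gF'.
  by exists (false :: w); rewrite /= sw ew; split=> //; lia.
have [gF' cF sF] := graph_del_dominating gF xV hx.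
have [w [sw ew pw]] := IH _ _ (cD x xV) gF'.
exists (true :: w); rewrite /= sw ew cF; rewrite (cD x xV) in sF *.
by split=> //; lia.
Qed.

End Graphs.

Lemma P2_le_wP2 n e E : E \in graphs n.+1 e ->
  exists w, [/\ size w = n, wedges w = e & P2 E <= wP2 w].
Proof.
rewrite inE => /andP[/eqP<- /forall_inP gE].
have [||w [sw ew pw]] := @sqdeg_le_wP2 _ n [set: 'I_n.+1] E.
- by rewrite cardsT card_ord.
- by apply/forall_inP => f /gE ->; rewrite subsetT.
exists w; split=> //; apply: leq_trans pw; rewrite /P2 /sqdeg.
by rewrite [X in _ <= X](eq_bigl xpredT) // => x; rewrite inE.
Qed.

Lemma optimalP n e pi : optimal n.+1 e pi <->
  exists w, [/\ size w = n, wedges w = e, parts w = pi & wopt w].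
Proof.
split=> [/andP[dis /forall_inP opt]|[w [sw <- <- ow]]].
  have [w [sw ew pw]] := Dis_parts dis; exists w; split=> // w' sw' ew'.
  have := opt (Th n.+1 (parts w')).
  rewrite -pw -sw P2_Th_parts -sw' P2_Th_parts.
  apply; apply: Th_graphs; rewrite -ew -ew'; exact: parts_Dis.
rewrite -sw /optimal parts_Dis /=.
apply/forall_inP => E /P2_le_wP2[w' [sw' ew' pw']].
by rewrite P2_Th_parts; apply: leq_trans pw' (ow _ sw' ew').
Qed.

(** * The balanced case *)

Lemma bin2_double n : 2 * 'C(n.+1, 2) = n.+1 * n.
Proof. by rewrite -mul_bin_diag bin1. Qed.

(** The intervals from C(k,2) to C(k+1,2) - 1 are disjoint. *)
Lemma lower_params_uniq e k j k' j' :
  lower_params e k j -> lower_params e k' j' -> k = k' /\ j = j'.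
Proof.
move=> /andP[/eqP h hj] /andP[/eqP h' hj'].
have := bin2_double k; have := bin2_double k' => b' b.
have kk' : k = k'.
  by case: (ltngtP k k') => // lt; [have [d E] : exists d, k' = (k + d).+1
    by exists (k' - k).-1; lia|have [d E] : exists d, k = (k' + d).+1
    by exists (k - k').-1; lia]; subst; nia.
by split=> //; subst k'; lia.
Qed.

Definition word21 c k := iso c (dom (k - 3) (iso 1 (dom 2 [::]))).
Definition word23 c k := iso c (dom (k - 2) (iso 2 [::])).

(** The parameters of the three families are (a+b+1, a+1), (a+2, a+2-m) and (b+3, 3). By uniqueness
    the first has a = 2, while the second would have a = k - 2, m = k - 3 and hence size at least 2k
    - 4. *)
Lemma quasi_complete_eq w k : 2 < k -> lower_params (wedges w) k 3 ->
    size w < 2 * k - 4 -> quasi_complete w ->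
  w = word21 (size w - k) k \/ w = word23 (size w - k) k.
Proof.
move=> k2 lp sw; have params K j : 0 < j <= K ->
    ((wedges w)%:Z * 2 + j%:Z * 2 = K.+1%:Z * K%:Z)%R -> K = k /\ j = 3.
  move=> jK E; apply: (lower_params_uniq _ lp); rewrite /lower_params jK andbT.
  by have := bin2_double K; lia.
case=> [[a] [b] [c] wE|[a] [m] [c] [hm wE]|[b] [c] wE].
- left; have [] := params (a + b).+1 a.+1.
  + by lia.
  + by rewrite wE !wordE /=; lia.
  move=> kE aE; rewrite /word21; have -> : size w - k = c.
    by rewrite wE !wordE /=; lia.
  have -> : k - 3 = b by lia.
  by have <- : a = 2 by lia.
- have [] := params a.+2 (a.+2 - m).
  + by lia.
  + have [d E] : exists d, a.+1 = m + d by exists (a.+1 - m); lia.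
    have -> : a.+2 - m = d.+1 by lia.
    have {}E : (a%:Z = m%:Z + d%:Z - 1)%R by lia.
    by rewrite wE !wordE /= -[a.+3]addn3 !PoszD E; lia.
  by move: sw; rewrite wE !wordE /=; lia.
right; have [] := params b.+3 3.
+ by lia.
+ by rewrite wE !wordE /=; lia.
move=> kE _; rewrite /word23; have -> : size w - k = c.
  by rewrite wE !wordE /=; lia.
by have -> : k - 2 = b.+1 by lia.
Qed.

Lemma run_recl a b : b <= a.+1 -> run a.+1 b = a.+1 :: run a b.
Proof.
move=> ba; rewrite /run subSn // -[(a.+1 - b).+1]addn1 iotaD cats1 rev_rcons.
by rewrite subnKC.
Qed.

Lemma run_cat a b c : b <= c.+1 -> c <= a -> run a b = run a c.+1 ++ run c b.
Proof.
move=> bc /subnK <-; elim: (a - c) => [|d IH].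
  by rewrite {2}/run subnn.
by rewrite addSn !run_recl ?IH //; lia.
Qed.

Lemma parts_dom a w :
  parts (dom a w) = run (size w + a) (size w).+1 ++ parts w.
Proof.
elim: a => [|a IH]; first by rewrite addn0 /run subnn.
rewrite [parts _]/= -/(dom a w) IH size_dom addnS run_recl ?ltnS ?leq_addr //.
by rewrite addnC.
Qed.

Lemma parts_iso a w : parts (iso a w) = parts w.
Proof. by elim: a. Qed.

Lemma exists_wopt w :
  exists w', [/\ size w' = size w, wedges w' = wedges w & wopt w'].
Proof.
pose P (t : (size w).-tuple bool) := wedges t == wedges w.
have [t /eqP et maxt] := @arg_maxnP _ (in_tuple w) P wP2 (eqxx _).
exists t; rewrite size_tuple; split=> // w'; rewrite size_tuple => sw ew.
apply: (maxt (Tuple (introT eqP sw))).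
by apply/eqP; rewrite -et.
Qed.

Section Balanced.

Variables (n k : nat).
Hypotheses (n9 : 8 < n) (hnk : n.+1 * n + 12 = 2 * (k.+1 * k)).

Let k_gt6 : 6 < k. Proof. nia. Qed.
Let k_lt : k < n. Proof. nia. Qed.
(** Since n is about sqrt(2) k, this holds from some point on. The solution n = 8, k = 6 gives
    equality, whence the bound v > 9. *)
Let n_lt : n < 2 * k - 4. Proof. nia. Qed.

Let word1 := word21 (n - k) k.
Let word2 := word23 (n - k) k.

Let e := 'C(n.+1, 2)./2.

Lemma balanced_edges : e * 2 + 6 = k.+1 * k /\ e.*2 = 'C(n.+1, 2).
Proof.
have := bin2_double n; have := bin2_double k; rewrite /e => b b'.
have : 'C(n.+1, 2) + 6 = 2 * 'C(k.+1, 2) by lia.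
by lia.
Qed.

Lemma balanced_lower_params : lower_params e k 3.
Proof.
have [h _] := balanced_edges; have := bin2_double k.
by rewrite /lower_params; lia.
Qed.

Lemma upper_lower_params k' j' :
  upper_params n.+1 e k' j' = lower_params e k' j'.
Proof.
have [_ h] := balanced_edges; rewrite /upper_params /lower_params -h.
by congr (_ && _); lia.
Qed.

(** The two words differ only in their first four vertices, by the exchange of triangle and star. *)
Lemma balanced_words w : w \in [:: word1; word2] ->
  [/\ size w = n, wedges w = e & wP2 w = wP2 word1].
Proof.
have [he _] := balanced_edges.
have [d kd] : exists d, k = d + 3 by exists (k - 3); lia.
have kd2 : k - 2 = d.+1 by lia.
have kd3 : k - 3 = d by lia.
have [c cE] : exists c, n = k + c by exists (n - k); lia.
have cE' : n - k = c by lia.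
move: he; rewrite /word1 /word2 /word21 /word23 cE' kd2 kd3 cE kd => he.
rewrite !inE => /orP[] /eqP->; split=> //; try by rewrite !wordE /=; lia.
- suff : ((wedges (iso c (dom d (iso 1 (dom 2 [::])))))%:Z * 2 = e%:Z * 2)%R
    by lia.
  by rewrite !wordE /=; lia.
- suff : ((wedges (iso c (dom d.+1 (iso 2 [::]))))%:Z * 2 = e%:Z * 2)%R by lia.
  by rewrite !wordE /=; lia.
suff : ((wP2 (iso c (dom d.+1 (iso 2 [::]))))%:Z =
  (wP2 (iso c (dom d (iso 1 (dom 2 [::])))))%:Z)%R by lia.
by rewrite !wordE /=; lia.
Qed.

Let words := [:: map negb word1; map negb word2; word1; word2].

Lemma words_stats w : w \in words ->
  [/\ size w = n, wedges w = e & wP2 w = wP2 word1].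
Proof.
rewrite -[words]/(map (map negb) [:: word1; word2] ++ [:: word1; word2]).
rewrite mem_cat.
case/orP => [/mapP[u /balanced_words[su eu pu] ->]|/balanced_words//].
have [h h2] := balanced_edges; have := bin2_double n; rewrite -h2 => b.
have := wedges_compl u; have := wP2_compl u; rewrite size_map su eu pu.
by split=> //; nia.
Qed.

Lemma wopt_words w : size w = n -> wedges w = e -> wopt w -> w \in words.
Proof.
move=> sw ew ow; have mem u : size u = n -> wedges u = e ->
    quasi_complete u -> u \in [:: word1; word2].
  move=> su eu qu; have lp : lower_params (wedges u) k 3.
    by rewrite eu balanced_lower_params.
  have su' : size u < 2 * k - 4 by rewrite su.
  have k2 : 2 < k by lia.
  by rewrite !inE; case: (quasi_complete_eq k2 lp su' qu) => ->;
    rewrite su eqxx ?orbT.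
rewrite -[words]/(map (map negb) [:: word1; word2] ++ [:: word1; word2]).
rewrite mem_cat.
have w0 : 0 < size w by rewrite sw; lia.
have [q|q] := wopt_quasi w0 ow.
  by rewrite (mem _ sw ew q) orbT.
rewrite -[w]map_negbK map_f // mem ?size_map //.
have [h h2] := balanced_edges; have := bin2_double n; rewrite -h2 => b.
by have := wedges_compl w; rewrite sw ew; lia.
Qed.

Lemma wopt_wordsE w :
  w \in words <-> [/\ size w = n, wedges w = e & wopt w].
Proof.
split=> [wW|[sw ew ow]]; last exact: wopt_words.
have [sw ew pw] := words_stats wW; split=> //.
have [u [su eu ou]] := exists_wopt w.
have [_ _ pu] := words_stats (wopt_words (etrans su sw) (etrans eu ew) ou).
by move=> w' sw' ew'; rewrite pw -pu; apply: ou; rewrite ?sw' ?ew'.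
Qed.

Lemma map_parts_words : map parts words =
  [:: run n k.+1 ++ [:: 3]; run n k.+1 ++ [:: 2; 1];
      run k 4 ++ [:: 2; 1]; run k 4 ++ [:: 3]].
Proof.
rewrite /words /word1 /word2 /word21 /word23 /= !map_negbE /=.
rewrite !parts_dom !parts_iso !parts_dom !size_iso !size_dom /=.
have -> : k - 3 + (1 + 2) = k by lia.
have -> : k - 2 + (2 + 0) = k by lia.
have -> : 1 + (2 + 0) + (k - 3) = k by lia.
have -> : 2 + 0 + (k - 2) = k by lia.
by rewrite subnKC ?(ltnW k_lt) // cats0 (@run_cat k 3 3) //; lia.
Qed.

Lemma balanced_optimal pi : optimal n.+1 e pi <-> pi \in map parts words.
Proof.
rewrite optimalP.
split=> [[w [sw ew <- ow]]|/mapP[w /wopt_wordsE[sw ew ow] ->]].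
  by apply/map_f/wopt_wordsE.
by exists w.
Qed.

Lemma uniq_partitions :
  uniq [:: run n k.+1 ++ [:: 3]; run n k.+1 ++ [:: 2; 1];
           run k 4 ++ [:: 2; 1]; run k 4 ++ [:: 3]].
Proof.
have runS a b : 0 < a -> b <= a -> exists s, run a b = a :: s.
  by case: a => // a _ ba; exists (run a b); rewrite run_recl.
have [s ->] : exists s, run n k.+1 = n :: s by apply: runS; lia.
have [t ->] : exists t, run k 4 = k :: t by apply: runS; lia.
have nk : (n == k) = false by lia.
by rewrite /= !inE !eqseq_cons nk /= !eqseq_cat //= !andbF.
Qed.

Lemma run_omit_eq : run_omit k 3 1 = run k 4 ++ [:: 2; 1].
Proof.
rewrite /run_omit (@run_cat k 1 3) // ?filter_cat; last by lia.
congr (_ ++ _); apply/all_filterP/allP => i.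
by rewrite mem_rev mem_iota; lia.
Qed.

End Balanced.

Theorem theorem5 (v k : nat) (hv : 9 < v) (hk : 0 < k)
    (hvk : ((2 * v%:Z - 1) ^+ 2 - 2 * (2 * k%:Z + 1) ^+ 2 = - 49 :> int)%R) :
  let e := 'C(v, 2)./2 in
  [/\ e.*2 = 'C(v, 2),
      exists! p : nat * nat, lower_params e p.1 p.2,
      exists! p : nat * nat, upper_params v e p.1 p.2 &
      forall ke j k' j' : nat,
        lower_params e ke j -> upper_params v e k' j' ->
        let q11 := run (v - 1) (k + 1) ++ [:: 3] in
        let q13 := run (v - 1) (k + 1) ++ [:: 2; 1] in
        let q21 := run k 4 ++ [:: 2; 1] in
        let q23 := run k 4 ++ [:: 3] in
        [/\ [/\ j = 3, j' = 3, ke = k & k' = k],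
            [/\ pi11 v k' j' = Some q11, pi13 v k' j' = Some q13,
                pi21 ke j = Some q21 & pi23 v ke j = Some q23],
            pi12 v k' j' = None /\ pi22 v ke j = None,
            uniq [:: q11; q13; q21; q23] &
            forall pi : seq nat,
              optimal v e pi <-> pi \in [:: q11; q13; q21; q23]]].
Proof.
case: v hv hvk => // n n9 hvk e.
have hnk : n.+1 * n + 12 = 2 * (k.+1 * k) by move: hvk; lia.
have k6 : 6 < k by nia.
have n_lt : n < 2 * k - 4 by nia.
have lower3 := balanced_lower_params n9 hnk.
have upperE k' j' := upper_lower_params n9 hnk k' j'.
split; first by have [] := balanced_edges n9 hnk.
- exists (k, 3); split=> // -[k' j'] /= h.
  by have [-> ->] := lower_params_uniq h lower3.
- exists (k, 3); split=> [|[k' j']] /=; rewrite upperE // => h.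
  by have [-> ->] := lower_params_uniq h lower3.
move=> ke j k' j' h; rewrite upperE => h'.
have [-> ->] := lower_params_uniq h lower3.
have [-> ->] := lower_params_uniq h' lower3.
rewrite subn1 /= addn1; split=> //.
- split=> //; first by rewrite /pi11 subn1 addn1.
  + rewrite /pi13 subn1 addn1 ifT //; lia.
  + by rewrite /pi21 (run_omit_eq n9 hnk).
  rewrite /pi23 ifT ?(@run_cat k 3 3) //; lia.
(* Both would require 2k - 4 <= v - 1. *)
- by rewrite /pi12 /pi22 !ifF //; apply/negbTE; lia.
- exact: uniq_partitions.
by move=> pi; rewrite -(map_parts_words n9 hnk); apply: balanced_optimal.
Qed.
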